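(* Let $n\in\mathbb{N}$, let $E$ be a Dedekind complete vector lattice, let $h\colon\mathbb{R}^n\to\mathbb{R}$ be a positively homogeneous and continuous function, and let $f_1,\dots,f_n\in E$. If $\{\overline{a^{\phi\psi}}\in\mathbb{R}^n : \phi\in\Phi,\ \psi\in\Psi\}$ provides a saddle representation for $h$, that is, if $$h(\bar{x})=\inf_{\phi\in\Phi}\ \sup_{\psi\in\Psi}\sum_{i=1}^{n}a_i^{\phi\psi}x_i=\sup_{\psi\in\Psi}\ \inf_{\phi\in\Phi}\sum_{i=1}^{n}a_i^{\phi\psi}x_i\qquad(\bar{x}\in\mathbb{R}^n),$$ then $$h(f_1,\dots,f_n)=\inf_{\phi\in\Phi}\ \sup_{\psi\in\Psi}\sum_{i=1}^{n}a_i^{\phi\psi}f_i=\sup_{\psi\in\Psi}\ \inf_{\phi\in\Phi}\sum_{i=1}^{n}a_i^{\phi\psi}f_i.$$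
   Context: A function $h\colon\mathbb{R}^n\to\mathbb{R}$ is positively homogeneous if $h(\lambda\bar{x})=\lambda h(\bar{x})$ for all $\lambda\in[0,\infty)$ and $\bar{x}\in\mathbb{R}^n$. A saddle representation of $h$ (by linear functions) is a two-index family of vectors $\overline{a^{\phi\psi}}=(a_1^{\phi\psi},\dots,a_n^{\phi\psi})\in\mathbb{R}^n$, indexed by $\phi\in\Phi$, $\psi\in\Psi$, satisfying the displayed hypothesis. A map is sublinear if it is positively homogeneous and subadditive, and superlinear if its negative is sublinear. For $\phi\colon\mathbb{R}^n\to\mathbb{R}$ sublinear, $\underline{\partial}\phi(\bar{0}):=\{\bar{a}\in\mathbb{R}^n: \sum_{i=1}^n a_ix_i\le\phi(\bar{x})\ \forall\bar{x}\in\mathbb{R}^n\}$; for $\psi$ superlinear, $\overline{\partial}\psi(\bar{0}):=\{\bar{a}\in\mathbb{R}^n: \sum_{i=1}^n a_ix_i\ge\psi(\bar{x})\ \forall\bar{x}\in\mathbb{R}^n\}$. For $f_1,\dots,f_n\in E$, $\phi(f_1,\dots,f_n):=\sup_{\bar{a}\in\underline{\partial}\phi(\bar{0})}\sum_{i=1}^n a_if_i$ and $\psi(f_1,\dots,f_n):=\inf_{\bar{a}\in\overline{\partial}\psi(\bar{0})}\sum_{i=1}^n a_if_i$ (these always exist in $E$). For $h$ continuous and positively homogeneous, $h(f_1,\dots,f_n)\in E$ is defined as $\inf_{\phi\in\Phi'}\phi(f_1,\dots,f_n)$ for any family $\Phi'$ of sublinear maps with $h=\inf_{\phi\in\Phi'}\phi$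 pointwise on $\mathbb{R}^n$, or equivalently as $\sup_{\psi\in\Psi'}\psi(f_1,\dots,f_n)$ for any family $\Psi'$ of superlinear maps with $h=\sup_{\psi\in\Psi'}\psi$ pointwise on $\mathbb{R}^n$; such families exist, and the value exists in $E$ and does not depend on the choice. *)

(* Defs.v *)
From HB Require Import structures.
From mathcomp Require Import all_boot all_order all_algebra.
From mathcomp Require Import all_classical all_reals all_analysis.

Set Implicit Arguments.
Unset Strict Implicit.
Unset Printing Implicit Defensive.

Import Order.TTheory GRing.Theory Num.Theory.
Import numFieldNormedType.Exports.

Local Open Scope classical_set_scope.
Local Open Scope ring_scope.

(* [supremums A] and [infimums A] are the sets of least upper bounds and of
   greatest lower bounds of A: they have at most one element, and are empty
   when the bound does not exist. *)
HB.mixin Record POrderedLmodule_isVectorLattice (R : numDomainType) E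
    of GRing.Lmodule R E & Num.POrderedZmodule E := {
  vlat_lerD2r : forall z x y : E, x <= y -> x + z <= y + z ;
  vlat_scaler_ge0 : forall (a : R) (x : E), 0 <= a -> 0 <= x -> 0 <= a *: x ;
  vlat_has_join : forall x y : E, supremums [set x; y] !=set0 ;
  vlat_has_meet : forall x y : E, infimums [set x; y] !=set0
}.

#[short(type="vectorLatticeType")]
HB.structure Definition VectorLattice (R : numDomainType) :=
  { E of GRing.Lmodule R E & Num.POrderedZmodule E
       & POrderedLmodule_isVectorLattice R E }.

Definition dedekind_complete (R : numDomainType) (E : vectorLatticeType R) :=
  forall A : set E, A !=set0 -> has_ubound A -> supremums A !=set0.

(* v = inf_phi sup_psi F phi psi, where all the bounds exist in T (the values
   +oo and -oo are not allowed, not even for the inner bounds); [sup_phi] is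
   the function phi |-> sup_psi F phi psi. *)
Definition is_inf_sup d (T : porderType d) (Phi Psi : Type)
    (F : Phi -> Psi -> T) (v : T) :=
  exists sup_phi : Phi -> T,
    (forall phi, supremums (range (F phi)) (sup_phi phi)) /\
    infimums (range sup_phi) v.

Definition is_sup_inf d (T : porderType d) (Phi Psi : Type)
    (F : Phi -> Psi -> T) (v : T) :=
  exists inf_psi : Psi -> T,
    (forall psi, infimums (range (F ^~ psi)) (inf_psi psi)) /\
    supremums (range inf_psi) v.

Section HomogeneousCalculus.
Context {R : realType} {n : nat}.
Implicit Types (h phi psi : 'rV[R]_n -> R) (a x : 'rV[R]_n).

Definition positively_homogeneous h :=
  forall (l : R) x, 0 <= l -> h (l *: x) = l * h x.

Definition sublinear phi :=
  positively_homogeneous phi /\ forall x y, phi (x + y) <= phi x + phi y.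

Definition superlinear psi := sublinear (fun x => - psi x).

Definition dotv a x : R := \sum_(i < n) a 0 i * x 0 i.

Definition subdiff0 phi : set 'rV[R]_n :=
  [set a | forall x, dotv a x <= phi x].

Definition superdiff0 psi : set 'rV[R]_n :=
  [set a | forall x, psi x <= dotv a x].

Definition saddle_representation (Phi Psi : Type) (a : Phi -> Psi -> 'rV[R]_n)
    h :=
  forall x, is_inf_sup (fun p q => dotv (a p q) x) (h x) /\
            is_sup_inf (fun p q => dotv (a p q) x) (h x).

Context {E : vectorLatticeType R}.
Implicit Types (f : 'I_n -> E) (v : E).

Definition lincomb a f : E := \sum_(i < n) a 0 i *: f i.

(* The default value 0 is irrelevant when E is Dedekind complete: the bounds
   below then exist for phi sublinear and psi superlinear. *)
Definition sublinear_calc phi f : E :=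
  supremum 0 [set lincomb a f | a in subdiff0 phi].

Definition superlinear_calc psi f : E :=
  infimum 0 [set lincomb a f | a in superdiff0 psi].

Definition pointwise_inf (Fam : set ('rV[R]_n -> R)) h :=
  forall x, infimums [set phi x | phi in Fam] (h x).

Definition pointwise_sup (Fam : set ('rV[R]_n -> R)) h :=
  forall x, supremums [set psi x | psi in Fam] (h x).

(* v is the value of h at f, computed by any family of sublinear maps with
   infimum h, or by any family of superlinear maps with supremum h. *)
Definition is_hom_calc h f v :=
  (forall Fam, Fam `<=` sublinear -> pointwise_inf Fam h ->
     infimums [set sublinear_calc phi f | phi in Fam] v) /\
  (forall Fam, Fam `<=` superlinear -> pointwise_sup Fam h ->
     supremums [set superlinear_calc psi f | psi in Fam] v).

(* For h continuous and positively homogeneous and E Dedekind complete there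
   is exactly one v with [is_hom_calc h f v]; otherwise the value may be
   arbitrary. *)
Definition hom_calc h f : E := xget 0 [set v | is_hom_calc h f v].

End HomogeneousCalculus.

(* Main.v *)
Require Import Defs.
From HB Require Import structures.
From mathcomp Require Import all_boot all_order all_algebra.
From mathcomp Require Import all_classical all_reals all_analysis.
From mathcomp Require Import finmap lra ring.

Set Implicit Arguments.
Unset Strict Implicit.
Unset Printing Implicit Defensive.

Import Order.TTheory GRing.Theory Num.Theory.
Import numFieldNormedType.Exports.

Local Open Scope classical_set_scope.
Local Open Scope ring_scope.

(** Everything rests on one transfer principle: if the two-level bounds of two
    families of linear forms satisfy
      [inf_A sup_(a in A) a.x <= sup_B inf_(b in B) b.x]
    at every point [x] of R^n, then the same inequality holds in [E] with [x]
    replaced by [f] ([inf_sup_le_sup_inf]).  Three instances give the theorem.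
    With subdifferentials against superdifferentials it says that the infimum
    of the [phi(f)] and the supremum of the [psi(f)] coincide, so that [h(f)]
    is well defined ([hom_calc_minimax]).  With singletons it says that a
    supremum of linear forms may be evaluated at [f] without passing to its
    whole subdifferential ([sublinear_calc_supremums]).  So
    [sup_psi a^{phi psi} f] is the value at [f] of the sublinear map
    [x |-> sup_psi a^{phi psi} x]; these maps have infimum [h], which is the
    first formula of the theorem, and the second is dual.

    The transfer principle is proved without representing [E] by functions.
    After subtraction it reads: if for every [x] and [eps] some member [C] of a
    family of bounded sets satisfies [c.x <= eps] on [C], and [z] is below
    [sup_(c in C) c.f] for all [C], then [z <= 0] ([le0_of_pointwise_le0]).
    Compactness of the unit sphere reduces the family to finitely many sets
    [C_1, ..., C_m], up to an error [eps * |x|] ([finite_selection]).  For any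
    choice of [c_k] in [C_k], every [x] then satisfies [c_k.x <= eps * |x|] for
    some [k], so that by a separation argument some convex combination of the
    [c_k] is at most [eps] in norm ([small_convex_combination]).  Writing
    [s_k] for the supremum of the [c.f] over [C_k], the vector
      [z + sum_k (c_k.f - s_k)]
    is below every [c_k.f], hence below [eps * e] with [e] a dominating vector
    that depends on [f] only.  Taking the suprema over the [c_k] one after the
    other leaves [z <= eps * e], and a Dedekind complete vector lattice is
    archimedean. *)

(** * The pairing of R^n and the supremum norm *)

Section LinearForms.
Context {R : realType} {n : nat}.
Implicit Types a b x y : 'rV[R]_n.

Lemma dotvC a x : dotv a x = dotv x a.
Proof. by apply: eq_bigr => i _; rewrite mulrC. Qed.

Lemma dotvDl a b x : dotv (a + b) x = dotv a x + dotv b x.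
Proof. by rewrite -big_split; apply: eq_bigr => i _; rewrite mxE mulrDl. Qed.

Lemma dotvZl l a x : dotv (l *: a) x = l * dotv a x.
Proof. by rewrite mulr_sumr; apply: eq_bigr => i _; rewrite mxE mulrA. Qed.

Lemma dotvNl a x : dotv (- a) x = - dotv a x.
Proof. by rewrite -scaleN1r dotvZl mulN1r. Qed.

Lemma dotvDr a x y : dotv a (x + y) = dotv a x + dotv a y.
Proof. by rewrite !(dotvC a) dotvDl. Qed.

Lemma dotvZr l a x : dotv a (l *: x) = l * dotv a x.
Proof. by rewrite !(dotvC a) dotvZl. Qed.

Lemma dotvNr a x : dotv a (- x) = - dotv a x.
Proof. by rewrite !(dotvC a) dotvNl. Qed.

Lemma dotv_ge0 a : 0 <= dotv a a.
Proof. by apply: sumr_ge0 => i _; rewrite -expr2 sqr_ge0. Qed.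

Lemma normr_coord_le a i : `|a 0 i| <= `|a|.
Proof.
by rewrite [leRHS]/Num.norm /= mx_normrE; apply/bigmax_geP; right; exists (0, i).
Qed.

Lemma normr_le_coord a M : 0 <= M -> (forall i, `|a 0 i| <= M) -> `|a| <= M.
Proof.
move=> M0 aM; rewrite [leLHS]/Num.norm /= mx_normrE; apply/bigmax_leP.
by split=> // -[j i] _ /=; rewrite ord1.
Qed.

(** Crude constant: the norm is the supremum norm on both sides, while the
    pairing is a sum of [n] products. *)
Lemma normr_dotv a x : `|dotv a x| <= n%:R * `|a| * `|x|.
Proof.
apply: le_trans (ler_norm_sum _ _ _) _.
have -> : n%:R * `|a| * `|x| = \sum_(i < n) `|a| * `|x|.
  by rewrite sumr_const card_ord -mulrA mulr_natl.
by apply: ler_sum => i _; rewrite normrM ler_pM ?normr_coord_le.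
Qed.

Lemma sqr_normr_le_dotv a : `|a| ^+ 2 <= dotv a a.
Proof.
suff h : `|a| <= Num.sqrt (dotv a a).
  by rewrite -(sqr_sqrtr (dotv_ge0 a)) ler_pXn2r ?nnegrE ?sqrtr_ge0.
apply: normr_le_coord => [|i]; first exact: sqrtr_ge0.
rewrite -sqrtr_sqr ler_wsqrtr // /dotv (bigD1 i) //= -expr2 lerDl.
by apply: sumr_ge0 => j _; rewrite -expr2 sqr_ge0.
Qed.

End LinearForms.

(** * Convex combinations of small norm *)

Definition simplex (R : realType) m : set 'rV[R]_m :=
  [set l | (forall k, 0 <= l 0 k) /\ \sum_k l 0 k = 1].
Arguments simplex {R} m _.

Section Hull.
Context {R : realType}.

(** First-order condition for the left end of [0, 1] to minimize the quadratic
    [2 t q + t^2 r]. *)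
Lemma quadratic_min (q r : R) : 0 <= r ->
  (forall t, 0 <= t <= 1 -> 0 <= t * q *+ 2 + t ^+ 2 * r) -> 0 <= q.
Proof.
move=> r0 h; rewrite leNgt; apply/negP => q0.
have d0 : 0 < 1 + r - q by lra.
(* For [q < 0] this [t] makes [t * r <= - q], so the linear term wins. *)
have := h (- q / (1 + r - q)); set t := - q / _.
have td : t * (1 + r - q) = - q by rewrite /t mulfVK // gt_eqF.
have t0 : 0 < t by rewrite divr_gt0 // oppr_gt0.
have t1 : t <= 1 by rewrite ler_pdivrMr //; lra.
rewrite (ltW t0) t1 => /(_ isT); apply/negP; rewrite -ltNge.
have -> : t * q *+ 2 + t ^+ 2 * r = t * (q *+ 2 + t * r) by ring.
rewrite pmulr_rlt0 //.
have : 0 <= t * (1 - q) by rewrite mulr_ge0 ?ltW //; lra.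
lra.
Qed.

Lemma continuous_sum_coord (T : topologicalType) m (F : 'I_m -> T -> R) :
  (forall k, continuous (F k)) -> continuous (fun x => \sum_k F k x).
Proof. by move=> cF; apply: continuous_big => //; exact: add_continuous. Qed.

Lemma compact_simplex m : compact (@simplex R m).
Proof.
apply: bounded_closed_compact.
  exists 1; split=> // M M1 l [l0 l1]; apply: normr_le_coord => [|k].
    by rewrite ltW // (lt_trans ltr01).
  rewrite ger0_norm // (le_trans _ (ltW M1)) // -l1 (bigD1 k) //= lerDl.
  exact: sumr_ge0.
have -> : @simplex R m = \bigcap_k [set l : 'rV[R]_m | 0 <= l 0 k] `&`
    (fun l : 'rV[R]_m => \sum_k l 0 k) @^-1` [set 1].
  by apply/seteqP; split=> l [l0 l1]; split=> // k; [move=> _|]; exact: l0.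
apply: closedI.
  apply: closed_bigI => k _.
  apply: (@preimage_closed _ _ (fun l : 'rV[R]_m => l 0 k) [set x | 0 <= x]).
    by move=> ? _; exact: coord_continuous.
  exact: closed_ge.
apply: preimage_closed; last exact: closed_eq.
by move=> ? _; apply: continuous_sum_coord => k; exact: coord_continuous.
Qed.

(** An approximate Gordan alternative.  The point [p] of least Euclidean norm in
    the convex hull of the [c k] satisfies [c k . p >= p . p] for all [k]; the
    hypothesis at [x = p] then gives [p . p <= eps * |p|], and [|p|^2 <= p . p]
    for the supremum norm. *)
Lemma small_convex_combination m n (c : 'I_m -> 'rV[R]_n) (eps : R) :
  0 <= eps -> (forall x, exists k, dotv (c k) x <= eps * `|x|) ->
  exists2 l : 'rV[R]_m, simplex m l & `|\sum_k l 0 k *: c k| <= eps.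
Proof.
move=> eps0 small; pose p (l : 'rV[R]_m) := \sum_k l 0 k *: c k.
have pD l l' : p (l + l') = p l + p l'.
  by rewrite -big_split; apply: eq_bigr => k _; rewrite mxE scalerDl.
have pZ t l : p (t *: l) = t *: p l.
  by rewrite /p scaler_sumr; apply: eq_bigr => k _; rewrite mxE scalerA.
have pe k : p (delta_mx 0 k) = c k.
  rewrite /p (bigD1 k) //= mxE !eqxx scale1r big1 ?addr0 // => j jk.
  by rewrite mxE (negPf jk) andbF scale0r.
have Se k : @simplex R m (delta_mx 0 k).
  split=> [j|]; first by rewrite mxE ler0n.
  rewrite (bigD1 k) //= mxE !eqxx big1 ?addr0 // => j jk.
  by rewrite mxE (negPf jk) andbF.
have S0 : @simplex R m !=set0 by have [k _] := small 0; exists (delta_mx 0 k).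
have cp i : continuous (fun l => p l 0 i).
  rewrite (_ : (fun _ => _) = fun l : 'rV[R]_m => \sum_k l 0 k * c k 0 i).
    apply: continuous_sum_coord => k l.
    have cl : {for l, continuous (fun l : 'rV[R]_m => l 0 k)}.
      exact: coord_continuous.
    exact: continuousM cl (@cst_continuous _ _ (c k 0 i) l).
  by apply/funext => l; rewrite summxE; apply: eq_bigr => k _; rewrite mxE.
have cg : continuous (fun l => dotv (p l) (p l)).
  by apply: continuous_sum_coord => i l; exact: continuousM (cp i l) (cp i l).
have [l /set_mem Sl lmin] := compact_EVT_min S0 (@compact_simplex m)
  (continuous_subspaceT cg).
exists l => //; rewrite -/(p l).
(* Variational inequality, from the segment that joins [p l] to [c k]. *)
have key k : dotv (p l) (p l) <= dotv (c k) (p l).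
  rewrite -subr_ge0 -dotvNl -dotvDl.
  apply: (quadratic_min (dotv_ge0 (c k - p l))) => t /andP[t0 t1].
  have : simplex m (l + t *: (delta_mx 0 k - l)).
    have -> : l + t *: (delta_mx 0 k - l) = (1 - t) *: l + t *: delta_mx 0 k.
      by rewrite scalerBr scalerBl scale1r addrA addrAC.
    have [l0 l1] := Sl; have [e0 e1] := Se k; split=> [j|].
      rewrite mxE [X in X + _]mxE [X in _ + X]mxE.
      by rewrite addr_ge0 // mulr_ge0 // subr_ge0.
    under eq_bigr => j _ do rewrite mxE [X in X + _]mxE [X in _ + X]mxE.
    by rewrite big_split -!mulr_sumr /= l1 e1 !mulr1 subrK.
  move=> /mem_set /lmin; rewrite pD pZ pD -scaleN1r pZ scaleN1r pe.
  move: (c k - p l) => d.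
  rewrite !(dotvDl, dotvDr, dotvZl, dotvZr) (dotvC (p l) d).
  by rewrite -subr_ge0; congr (0 <= _); ring.
have [p0|p0] := eqVneq (`|p l|) 0; first by rewrite p0.
have [k hk] := small (p l).
rewrite -(@ler_pM2r _ `|p l|) ?lt_def ?p0 //= -expr2.
exact: le_trans (sqr_normr_le_dotv _) (le_trans (key k) hk).
Qed.

End Hull.

(** * Compactness: from a family of sets to finitely many *)

Section FiniteSelection.
Context {R : realType} {n : nat}.
Implicit Types (C : set 'rV[R]_n) (cC : set (set 'rV[R]_n)).

Definition norm_bounded C := exists M, forall c, C c -> `|c| <= M.

Lemma compact_unit_sphere : compact [set x : 'rV[R]_n | `|x| = 1].
Proof.
apply: bounded_closed_compact.
  by exists 1; split=> // M M1 x /= ->; exact: ltW.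
apply: (@preimage_closed _ _ (fun x : 'rV[R]_n => `|x|) [set 1]).
  by move=> x _; exact: norm_continuous.
exact: closed_eq.
Qed.

(** Each bounded [C] that is good at [x] remains good near [x], uniformly over
    its elements, because the forms in [C] have a common Lipschitz constant;
    finitely many such neighbourhoods cover the unit sphere, and homogeneity
    extends the estimate to all of R^n. *)
Lemma finite_selection cC :
  (forall C, cC C -> norm_bounded C) ->
  (forall x eps, 0 < eps -> exists2 C, cC C & forall c, C c -> dotv c x <= eps) ->
  forall eps, 0 < eps ->
  exists m (D : 'I_m -> set 'rV[R]_n), (forall k, cC (D k)) /\
    forall x, exists k, forall c, D k c -> dotv c x <= eps * `|x|.
Proof.
move=> bC smallC eps eps0.
have e2 : 0 < eps / 2 by rewrite divr_gt0.
have near x : exists Cr : set 'rV[R]_n * R, [/\ cC Cr.1, 0 < Cr.2 &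
    forall c y, Cr.1 c -> ball x Cr.2 y -> dotv c y <= eps].
  have [C CC Cx] := smallC x _ e2; have [M CM] := bC _ CC.
  pose r := eps / 2 / (n%:R * `|M| + 1).
  have d0 : 0 < n%:R * `|M| + 1 by rewrite ltr_wpDl // mulr_ge0.
  exists (C, r); split=> //= [|c y Cc]; first by rewrite divr_gt0.
  rewrite -ball_normE /= => xy; rewrite -[y](subrK x) dotvDr.
  rewrite [leRHS](splitr eps) lerD ?Cx //.
  apply: le_trans (ler_norm _) (le_trans (normr_dotv _ _) _).
  apply: (@le_trans _ _ ((n%:R * `|M| + 1) * r)).
    rewrite ler_pM ?mulr_ge0 //; last by rewrite distrC ltW.
    apply: (@le_trans _ _ (n%:R * `|M|)); last by rewrite lerDl.
    by rewrite ler_wpM2l // (le_trans (CM _ Cc)) // ler_norm.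
  by rewrite /r mulrC mulfVK ?gt_eqF.
have [Cr CrP] := choice near.
have := @compact_unit_sphere; rewrite compact_cover => /(_ _ setT
  (fun x => ball x (Cr x).2)) [x _||F _ cov].
- exact: ball_open.
- by move=> x _; exists x => //; apply: ballxx; case: (CrP x).
(* The point 0 is added so that the selection is nonempty when n = 0. *)
pose s := 0 :: enum_fset F.
exists (size s), (fun k => (Cr (nth 0 s k)).1); split=> [k|x].
  by case: (CrP (nth 0 s k)).
have [->|x0] := eqVneq x 0.
  exists ord0 => c _; rewrite normr0 mulr0.
  by rewrite -(scale0r 0) dotvZr mul0r.
have nx : 0 < `|x| by rewrite normr_gt0.
have [z /= zF bz] : cover [set` F] (fun z => ball z (Cr z).2) (`|x|^-1 *: x).
  by apply: cov; rewrite /= normrZ ger0_norm ?invr_ge0 // mulVf // gt_eqF.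
have zs : z \in s by rewrite inE [X in _ || X]zF orbT.
move: (zs); rewrite -index_mem => ks; exists (Ordinal ks) => c /=.
rewrite nth_index // => Cc; have [_ _ /(_ _ _ Cc bz)] := CrP z.
by rewrite dotvZr ler_pdivrMl // mulrC.
Qed.

End FiniteSelection.

(** * Sublinear maps are attained by their subdifferentials *)

Section HahnBanach.
Context {R : realType} {n : nat}.
Implicit Types (phi : 'rV[R]_n -> R) (a x y : 'rV[R]_n).

Lemma sublinear0 phi : sublinear phi -> phi 0 = 0.
Proof. by move=> [hom _]; rewrite -(scale0r 0) hom ?mul0r. Qed.

Lemma sublinearN_ge phi x : sublinear phi -> - phi (- x) <= phi x.
Proof.
move=> sl; rewrite lerNl -subr_ge0 opprK -(sublinear0 sl) -(subrr x) addrC.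
exact: sl.2.
Qed.

(** The one-dimensional step of Hahn-Banach.  The map
    [phi' x = inf_(t >= 0) phi (x + t y) - t phi y] is sublinear; [t = 0] gives
    [phi' <= phi], and [t = 1] at [x = - y] gives [phi' (- y) <= - phi y], so
    that [phi'] is linear on the line of [y] and agrees there with [phi] at
    [y]. *)
Lemma sublinear_linear_along phi y : sublinear phi ->
  exists phi', [/\ sublinear phi', forall x, phi' x <= phi x &
    phi' (- y) <= - phi y].
Proof.
move=> sl; have [hom sub] := sl.
pose S x := [set phi (x + t *: y) - t * phi y | t in [set t | 0 <= t]].
have lbS x : lbound (S x) (- phi (- x)).
  move=> _ [t /= t0 <-]; rewrite lerBrDr -hom // addrC lerBlDr.
  by apply: le_trans (sub _ _); rewrite addrAC subrr add0r.
have hlb x : has_lbound (S x) by exists (- phi (- x)).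
have S0 x : S x !=set0 by exists (phi (x + 0 *: y) - 0 * phi y); exists 0 => /=.
pose phi' x := inf (S x).
have leS x t : 0 <= t -> phi' x <= phi (x + t *: y) - t * phi y.
  by move=> t0; apply: ge_inf => //; exists t.
have geS x m : (forall t, 0 <= t -> m <= phi (x + t *: y) - t * phi y) ->
    m <= phi' x.
  by move=> h; apply: lb_le_inf => // _ [t /= t0 <-]; exact: h.
have leZ l x : 0 < l -> phi' (l *: x) <= l * phi' x.
  move=> l0; rewrite -ler_pdivrMl //; apply: geS => t t0.
  rewrite ler_pdivrMl // mulrBr mulrA -(hom l _ (ltW l0)) scalerDr scalerA.
  by apply: leS; rewrite mulr_ge0 // ltW.
exists phi'; split.
- split=> [l x|x x'].
    rewrite le_eqVlt => /orP[/eqP<-|l0].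
      rewrite scale0r mul0r; apply/le_anti/andP; split.
        apply: le_trans (leS _ 0 _) _ => //.
        by rewrite scale0r mul0r subr0 addr0 sublinear0.
      by apply: geS => t t0; rewrite add0r hom // subrr.
    apply/le_anti/andP; split; first exact: leZ.
    rewrite -ler_pdivlMl // -{1}(scalerK (lt0r_neq0 l0) x).
    by apply: leZ; rewrite invr_gt0.
  rewrite -lerBlDr; apply: (geS) => t t0; rewrite lerBlDl -lerBlDr.
  apply: (geS) => s s0; rewrite lerBlDr.
  apply: le_trans (leS _ (s + t) _) _; first exact: addr_ge0.
  have -> : x + x' + (s + t) *: y = (x' + s *: y) + (x + t *: y).
    by rewrite scalerDl [RHS]addrACA (addrC x').
  by rewrite mulrDl; have := sub (x' + s *: y) (x + t *: y); lra.
- move=> x; apply: le_trans (leS _ 0 _) _ => //.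
  by rewrite scale0r mul0r subr0 addr0.
- apply: le_trans (leS _ 1 _) _ => //.
  by rewrite scale1r mul1r addNr sublinear0 // sub0r.
Qed.

(** Lowering a sublinear map preserves its linearity along a vector, so the
    one-dimensional step can be iterated. *)
Lemma sublinear_linear_along_seq (s : seq 'rV[R]_n) phi : sublinear phi ->
  exists phi', [/\ sublinear phi', forall x, phi' x <= phi x &
    forall y, y \in s -> phi' (- y) <= - phi' y].
Proof.
elim: s phi => [|y s IH] phi sl; first by exists phi.
have [phi1 [sl1 le1 lin1]] := sublinear_linear_along y sl.
have [phi' [sl' le' lin']] := IH _ sl1.
exists phi'; split=> // [x|x]; first exact: le_trans (le1 x).
rewrite inE => /orP[/eqP->|]; last exact: lin'.
apply: le_trans (le' _) (le_trans lin1 _).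
by rewrite lerN2 (le_trans (le' y)).
Qed.

(** Hahn-Banach in R^n: making [phi] linear along [x] first and then along the
    canonical basis leaves a linear form below [phi] with the same value at
    [x]. *)
Lemma subdiff0_attained phi x : sublinear phi ->
  exists2 a, subdiff0 phi a & dotv a x = phi x.
Proof.
move=> sl; have [phi1 [sl1 le1 lin1]] := sublinear_linear_along x sl.
have [phi' [sl' le' lin']] :=
  sublinear_linear_along_seq [seq delta_mx 0 i | i <- enum 'I_n] sl1.
pose a : 'rV[R]_n := \row_i phi' (delta_mx 0 i).
have le_a y : phi' y <= dotv a y.
  rewrite [y in phi' y]row_sum_delta /dotv.
  elim/big_ind2 : _ => [|u u' v v' hu hv|i _].
  - by rewrite sublinear0.
  - by apply: le_trans (sl'.2 _ _) _; exact: lerD.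
  rewrite mxE; have [y0|/ltW y0] := leP 0 (y 0 i).
    by rewrite sl'.1 // mulrC.
  rewrite -[y 0 i]opprK scaleNr -scalerN sl'.1 ?oppr_ge0 // mulrN mulrC -mulNr.
  rewrite ler_wpM2r ?oppr_ge0 //.
  by apply: lin'; rewrite map_f // mem_enum.
have a_phi' y : dotv a y <= phi' y.
  rewrite -[y]opprK dotvNr; apply: le_trans (sublinearN_ge _ sl').
  by rewrite lerN2 !opprK.
exists a => [y|]; first exact: le_trans (a_phi' y) (le_trans (le' y) (le1 y)).
apply/le_anti/andP; split.
  exact: le_trans (a_phi' x) (le_trans (le' x) (le1 x)).
rewrite -lerN2 -dotvNr; apply: le_trans (a_phi' _) (le_trans (le' _) lin1).
Qed.

Lemma norm_bounded_subdiff0 phi : norm_bounded (subdiff0 phi).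
Proof.
pose e i : 'rV[R]_n := delta_mx 0 i.
have ae a i : dotv a (e i) = a 0 i.
  rewrite /dotv (bigD1 i) //= mxE !eqxx mulr1 big1 ?addr0 // => j ji.
  by rewrite mxE (negPf ji) andbF mulr0.
have h i : 0 <= `|phi (e i)| + `|phi (- e i)| by rewrite addr_ge0.
exists (\sum_i (`|phi (e i)| + `|phi (- e i)|)) => a sa.
apply: normr_le_coord => [|i]; first exact: sumr_ge0.
apply: (@le_trans _ _ (`|phi (e i)| + `|phi (- e i)|)); last first.
  by rewrite [leRHS](bigD1 i) //= lerDl sumr_ge0.
have := sa (e i); have := sa (- e i); rewrite dotvNr ae => h1 h2.
rewrite ler_norml lerNl; apply/andP; split.
  by apply: le_trans h1 (le_trans (ler_norm _) _); rewrite lerDr.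
by apply: le_trans h2 (le_trans (ler_norm _) _); rewrite lerDl.
Qed.

End HahnBanach.

(** * Order in vector lattices *)

Section VectorLatticeOrder.
Context {R : realType} {E : vectorLatticeType R}.
Implicit Types (u v w z : E) (A B : set E).

Lemma vlerD2r w u v : (u + w <= v + w) = (u <= v).
Proof.
apply/idP/idP => [/(vlat_lerD2r (- w))|]; last exact: vlat_lerD2r.
by rewrite !addrK.
Qed.

Lemma vlerD u v w z : u <= v -> w <= z -> u + w <= v + z.
Proof.
move=> uv wz; apply: (@le_trans _ _ (v + w)); first by rewrite vlerD2r.
by rewrite ![v + _]addrC vlerD2r.
Qed.

Lemma vlerBrDr w u v : (u <= v - w) = (u + w <= v).
Proof. by rewrite -(vlerD2r w u) subrK. Qed.

Lemma vlerBlDr w u v : (u - w <= v) = (u <= v + w).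
Proof. by rewrite -(vlerD2r w (u - w)) subrK. Qed.

Lemma vsubr_ge0 u v : (0 <= v - u) = (u <= v).
Proof. by rewrite vlerBrDr add0r. Qed.

Lemma vlerN2 u v : (- u <= - v) = (v <= u).
Proof. by rewrite -[LHS]vsubr_ge0 opprK addrC vsubr_ge0. Qed.

Lemma vler_scale (l : R) u v : 0 <= l -> u <= v -> l *: u <= l *: v.
Proof.
by move=> l0 uv; rewrite -vsubr_ge0 -scalerBr vlat_scaler_ge0 // vsubr_ge0.
Qed.

Lemma vler_scale_r (l m : R) v : 0 <= v -> l <= m -> l *: v <= m *: v.
Proof.
by move=> v0 lm; rewrite -vsubr_ge0 -scalerBl vlat_scaler_ge0 // subr_ge0.
Qed.

Lemma vler_sum (I : Type) (r : seq I) (P : pred I) (F G : I -> E) :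
  (forall i, P i -> F i <= G i) ->
  \sum_(i <- r | P i) F i <= \sum_(i <- r | P i) G i.
Proof.
by move=> FG; elim/big_ind2 : _ => // *; exact: vlerD.
Qed.

Lemma vsumr_ge0 (I : Type) (r : seq I) (P : pred I) (F : I -> E) :
  (forall i, P i -> 0 <= F i) -> 0 <= \sum_(i <- r | P i) F i.
Proof.
by move=> F0; elim/big_rec : _ => // i v /F0 Fi v0; rewrite -[0]addr0 vlerD.
Qed.

(** A Minkowski sum of sets has the sum of their suprema as supremum; this is
    the form in which the choices of one element per set are eliminated. *)
Lemma supremums_sum m (S : 'I_m -> set E) (s : 'I_m -> E) w :
  (forall k, supremums (S k) (s k)) ->
  (forall t : 'I_m -> E, (forall k, S k (t k)) -> \sum_k t k <= w) ->
  \sum_k s k <= w.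
Proof.
elim: m S s w => [|m IH] S s w supS ubw.
  by apply: le_trans (ubw s _); [rewrite !big_ord0|case].
rewrite big_ord_recl -vlerBrDr; apply: (supS ord0).2 => t0 St0.
rewrite vlerBrDr addrC -vlerBrDr.
apply: IH (fun k => S (lift ord0 k)) _ _ (fun k => supS (lift ord0 k)) _ => t St.
pose t' k := oapp t t0 (unlift ord0 k).
have t'0 : t' ord0 = t0 by rewrite /t' unlift_none.
have t'S k : t' (lift ord0 k) = t k by rewrite /t' liftK.
rewrite vlerBrDr addrC; apply: le_trans (ubw t' _).
  by rewrite big_ord_recl t'0 (eq_bigr _ (fun k _ => t'S k)).
by move=> k; case: (unliftP ord0 k) => [j|] ->; rewrite ?t'0 ?t'S.
Qed.

Context (E_complete : dedekind_complete E).

(** If [s] is the supremum of the positive multiples of [z], then [s - z] is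
    another upper bound of them, so that [s <= s - z]. *)
Lemma archimedean z e :
  (forall eps : R, 0 < eps -> z <= eps *: e) -> z <= 0.
Proof.
move=> ze; pose A := [set k.+1%:R *: z | k in [set: nat]].
have [||s [ubs lubs]] := E_complete (A := A).
  by exists (1%:R *: z), 0%N.
- exists e => _ [k _ <-].
  have k0 : 0 < k.+1%:R :> R by rewrite ltr0n.
  have := vler_scale (ltW k0) (ze k.+1%:R^-1 _).
  by rewrite scalerA mulfV ?gt_eqF // scale1r invr_gt0; exact.
have : s <= s - z.
  apply: lubs => _ [k _ <-]; rewrite vlerBrDr.
  rewrite -{2}[z]scale1r -scalerDl natr1.
  by apply: ubs; exists k.+1.
by rewrite vlerBrDr -{2}[s]add0r addrC vlerD2r.
Qed.

End VectorLatticeOrder.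

(** Stated for an order-reversing involution so that it serves for negation both
    in R and in a vector lattice. *)
Lemma infimums_antitone d (T : porderType d) (g : T -> T) (A : set T) v :
  involutive g -> {mono g : u w /~ (u <= w)%O} ->
  infimums A v <-> supremums (g @` A) (g v).
Proof.
move=> gK gM; have gMl u w : (g u <= w)%O = (g w <= u)%O.
  by rewrite -{1}[w]gK gM.
split=> -[lb glb]; split=> [|w wA].
- by move=> _ [u Au <-]; rewrite gM; exact: lb.
- by rewrite gMl; apply: glb => u Au; rewrite gMl; apply: wA; exists u.
- by move=> u Au; rewrite -gM; apply: lb; exists u.
- by rewrite -gM; apply: glb => _ [u Au <-]; rewrite gM; exact: wA.
Qed.

Lemma infimums_adherent d (T : orderType d) (S : set T) m v :
  infimums S m -> (m < v)%O -> exists2 s, S s & (s < v)%O.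
Proof.
move=> [_ mS] mv; apply: contrapT => no.
suff /mS : lbound S v by rewrite leNgt mv.
by move=> s Ss; rewrite leNgt; apply/negP => sv; apply: no; exists s.
Qed.

Lemma supremums_adherent d (T : orderType d) (S : set T) m v :
  supremums S m -> (v < m)%O -> exists2 s, S s & (v < s)%O.
Proof.
move=> [_ mS] vm; apply: contrapT => no.
suff /mS : ubound S v by rewrite leNgt vm.
by move=> s Ss; rewrite leNgt; apply/negP => vs; apply: no; exists s.
Qed.

(** * From inequalities on R^n to inequalities in the vector lattice *)

Section Calculus.
Context {R : realType} {n : nat} {E : vectorLatticeType R}.
Context (E_complete : dedekind_complete E).
Implicit Types (a b c : 'rV[R]_n) (f : 'I_n -> E) (A : set E).

Lemma lincombD a b f : lincomb (a + b) f = lincomb a f + lincomb b f.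
Proof. by rewrite -big_split; apply: eq_bigr => i _; rewrite mxE scalerDl. Qed.

Lemma lincombZ (l : R) a f : lincomb (l *: a) f = l *: lincomb a f.
Proof. by rewrite scaler_sumr; apply: eq_bigr => i _; rewrite mxE scalerA. Qed.

Lemma lincombN a f : lincomb (- a) f = - lincomb a f.
Proof. by rewrite -scaleN1r lincombZ scaleN1r. Qed.

Lemma lincombB a b f : lincomb (a - b) f = lincomb a f - lincomb b f.
Proof. by rewrite lincombD lincombN. Qed.

Lemma lincomb_sum m (l : 'I_m -> R) (c : 'I_m -> 'rV[R]_n) f :
  lincomb (\sum_k l k *: c k) f = \sum_k l k *: lincomb (c k) f.
Proof.
elim/big_ind2 : _ => [|a u b v <- <-|k _]; last by rewrite lincombZ.
  by rewrite -(scale0r 0) lincombZ scale0r.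
by rewrite lincombD.
Qed.

(** The vector [e] is a sum of upper bounds of [f i] and [- f i]. *)
Lemma lincomb_le_norm f :
  exists2 e : E, 0 <= e & forall a, lincomb a f <= `|a| *: e.
Proof.
have /choice[e eP] i : exists e : E, f i <= e /\ - f i <= e.
  have [e [ube _]] := vlat_has_join (f i) (- f i).
  by exists e; split; apply: ube; [left|right].
have e0 i : 0 <= e i.
  have [e1 e2] := eP i; have := vlerD e1 e2.
  rewrite subrr -mulr2n -scaler_nat => h.
  have := @vler_scale _ _ 2^-1 _ _ _ h.
  by rewrite scaler0 scalerA mulVf // scale1r; apply; rewrite invr_ge0.
exists (\sum_i e i) => [|a]; first exact: vsumr_ge0.
rewrite scaler_sumr; apply: vler_sum => i _.
apply: (@le_trans _ _ (`|a 0 i| *: e i)); last first.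
  by rewrite vler_scale_r // normr_coord_le.
have [e1 e2] := eP i; have [a0|/ltW a0] := leP 0 (a 0 i).
  by rewrite ger0_norm // vler_scale.
rewrite ler0_norm // -[a 0 i *: f i]opprK -scaleNr -scalerN.
by rewrite vler_scale // oppr_ge0.
Qed.

Lemma has_ubound_lincomb (C : set 'rV[R]_n) f :
  norm_bounded C -> has_ubound [set lincomb c f | c in C].
Proof.
move=> [M CM]; have [e e0 fe] := lincomb_le_norm f.
exists (M *: e) => _ [c Cc <-]; apply: le_trans (fe c) _.
by rewrite vler_scale_r // CM.
Qed.

(** The transfer principle in its one-sided form.  The hypothesis on [z] speaks
    of upper bounds instead of suprema, so that it can be checked on sets whose
    supremum has not been computed. *)
Lemma le0_of_pointwise_le0 (cC : set (set 'rV[R]_n)) f z :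
  (forall C, cC C -> norm_bounded C) ->
  (forall x eps, 0 < eps -> exists2 C, cC C & forall c, C c -> dotv c x <= eps) ->
  (forall C, cC C -> lbound (ubound [set lincomb c f | c in C]) z) ->
  z <= 0.
Proof.
move=> bC smallC zC; have [e e0 fe] := lincomb_le_norm f.
apply: (archimedean E_complete (e := e)) => eps eps0.
have [m [D [DC small]]] := finite_selection bC smallC eps0.
pose S k := [set lincomb c f | c in D k].
(* An empty set has no supremum, but then 0 is among its upper bounds. *)
have [[k S0]|Sn0] := pselect (exists k, S k = set0).
  apply: (@le_trans _ _ 0); last by rewrite vlat_scaler_ge0 // ltW.
  by apply: (zC _ (DC k)); rewrite -/(S k) S0.
have /choice[s sP] k : exists s, supremums (S k) s.
  apply: E_complete; last exact/has_ubound_lincomb/bC.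
  by apply/set0P/negP => /eqP S0; apply: Sn0; exists k.
have zs k : z <= s k by apply: (zC _ (DC k)); case: (sP k).
suff : \sum_k s k <= eps *: e - z + \sum_k s k.
  by rewrite -{1}[\sum_k s k]add0r vlerD2r vsubr_ge0.
apply: (supremums_sum sP) => t tS.
have /choice[c cP] k : exists c, D k c /\ lincomb c f = t k.
  by have [c Dc ct] := tS k; exists c.
have [l [l0 l1] lc] : exists2 l : 'rV[R]_m, simplex m l &
    `|\sum_k l 0 k *: c k| <= eps.
  apply: small_convex_combination => [|x]; first exact: ltW.
  by have [k hk] := small x; exists k; apply: hk; case: (cP k).
pose w := z + \sum_j (t j - s j).
(* All the summands are nonpositive: keep only [t k - s k], and [z <= s k]. *)
have wt k : w <= t k.
  rewrite /w (bigD1 k) //= -[leRHS](subrK (s k)).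
  rewrite [leRHS]addrC vlerD ?zs // -[leRHS]addr0 vlerD //.
  rewrite -vsubr_ge0 sub0r -sumrN.
  by apply: vsumr_ge0 => j _; rewrite opprB vsubr_ge0; exact: (sP j).1 (tS j).
rewrite -[leRHS]addrA (addrC (- z)) addrA -vlerBlDr opprK -vlerBlDr addrAC.
rewrite addrC -sumrB -/w.
have -> : w = \sum_k l 0 k *: w by rewrite -scaler_suml l1 scale1r.
apply: (@le_trans _ _ (\sum_k l 0 k *: t k)).
  by apply: vler_sum => k _; exact: vler_scale.
rewrite (eq_bigr (fun k => l 0 k *: lincomb (c k) f)).
  by rewrite -lincomb_sum (le_trans (fe _)) // vler_scale_r.
by move=> k _; rewrite (cP k).2.
Qed.

End Calculus.

Section HomogeneousCalculus.
Context {R : realType} {n : nat} {E : vectorLatticeType R}.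
Context (E_complete : dedekind_complete E) (f : 'I_n -> E).
Implicit Types (a b c x : 'rV[R]_n) (A B : set 'rV[R]_n).
Implicit Types (phi psi : 'rV[R]_n -> R).

(** The transfer principle: apply the one-sided form to the sets of differences
    [A - B]. *)
Lemma inf_sup_le_sup_inf (cA cB : set (set 'rV[R]_n)) u w :
  (forall A, cA A -> norm_bounded A) -> (forall B, cB B -> norm_bounded B) ->
  (forall x eps, 0 < eps -> exists A B, [/\ cA A, cB B &
     forall a b, A a -> B b -> dotv a x <= dotv b x + eps]) ->
  (forall A, cA A -> lbound (ubound [set lincomb a f | a in A]) u) ->
  (forall B, cB B -> ubound (lbound [set lincomb b f | b in B]) w) ->
  u <= w.
Proof.
move=> bA bB small uA wB; rewrite -[w]add0r -vlerBlDr.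
pose cC := [set [set a - b | a in A & b in B] | A in cA & B in cB].
apply: (le0_of_pointwise_le0 E_complete (cC := cC) (f := f)).
- move=> _ [A cAA [B cBB <-]]; have [M AM] := bA _ cAA.
  have [N BN] := bB _ cBB; exists (M + N) => _ [a Aa [b Bb <-]].
  by rewrite (le_trans (ler_normB _ _)) // lerD ?AM ?BN.
- move=> x eps eps0; have [A [B [cAA cBB AB]]] := small x _ eps0.
  exists [set a - b | a in A & b in B]; first by exists A => //; exists B.
  move=> _ [a Aa [b Bb <-]].
  by rewrite dotvDl dotvNl lerBlDr addrC; exact: AB.
- move=> _ [A cAA [B cBB <-]] v vub.
  rewrite vlerBlDr addrC -vlerBlDr; apply: (wB _ cBB) => _ [b Bb <-].
  rewrite vlerBlDr; apply: (uA _ cAA) => _ [a Aa <-].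
  rewrite addrC -vlerBlDr -lincombB; apply: vub.
  by exists (a - b) => //; exists a => //; exists b.
Qed.

(** Singletons have trivial inner bounds, so the transfer principle for families
    of singletons compares a plain infimum with a plain supremum. *)
Lemma inf_le_sup A B u w :
  (forall x eps, 0 < eps -> exists a b, [/\ A a, B b &
     dotv a x <= dotv b x + eps]) ->
  (forall a, A a -> u <= lincomb a f) -> (forall b, B b -> lincomb b f <= w) ->
  u <= w.
Proof.
move=> small uA wB.
have b1 (D C : set 'rV[R]_n) : [set [set c] | c in D] C -> norm_bounded C.
  by move=> [c _ <-]; exists `|c| => _ ->.
apply: (inf_sup_le_sup_inf (b1 A) (b1 B)).
- move=> x eps eps0; have [a [b [Aa Bb ab]]] := small x _ eps0.
  exists [set a], [set b]; split; [by exists a|by exists b|].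
  by move=> _ _ -> ->.
- move=> _ [a Aa <-] v vub; apply: le_trans (uA _ Aa) _.
  by apply: vub; exists a.
- move=> _ [b Bb <-] v vlb; apply: le_trans _ (wB _ Bb).
  by apply: vlb; exists b.
Qed.

(** * The calculus for sublinear and superlinear maps *)

Lemma sublinear_calcP phi : sublinear phi ->
  supremums [set lincomb a f | a in subdiff0 phi] (sublinear_calc phi f).
Proof.
move=> sl; have [a sa _] := subdiff0_attained 0 sl.
have S0 : [set lincomb a f | a in subdiff0 phi] !=set0.
  by exists (lincomb a f); exists a.
rewrite /sublinear_calc /supremum; case: ifPn => [/eqP S0'|_].
  by move: S0; rewrite S0' => -[].
apply: xgetPex; apply: E_complete => //.
exact/has_ubound_lincomb/norm_bounded_subdiff0.
Qed.

Lemma superdiff0N psi a :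
  superdiff0 psi a <-> subdiff0 (fun x => - psi x) (- a).
Proof. by split=> sa x; have := sa x; rewrite dotvNl lerN2. Qed.

Lemma superdiff0_opp psi : superdiff0 psi = -%R @` subdiff0 (fun x => - psi x).
Proof.
apply/seteqP; split=> [a /superdiff0N sa|_ [a sa <-]].
  by exists (- a); rewrite ?opprK.
by apply/superdiff0N; rewrite opprK.
Qed.

Lemma norm_bounded_superdiff0 psi : norm_bounded (superdiff0 psi).
Proof.
have [M sM] := norm_bounded_subdiff0 (fun x => - psi x).
by exists M => a /superdiff0N /sM; rewrite normrN.
Qed.

Lemma superdiff0_attained psi x : superlinear psi ->
  exists2 a, superdiff0 psi a & dotv a x = psi x.
Proof.
move=> sl; have [a sa ax] := subdiff0_attained x sl.
exists (- a); first by apply/superdiff0N; rewrite opprK.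
by rewrite dotvNl ax opprK.
Qed.

Let vinfimums_opp (S : set E) v : infimums S v <-> supremums (-%R @` S) (- v).
Proof. by apply: infimums_antitone => [|u w]; [exact: opprK|exact: vlerN2]. Qed.

Let infimums_superdiff0 psi : superlinear psi ->
  infimums [set lincomb a f | a in superdiff0 psi]
    (- sublinear_calc (fun x => - psi x) f).
Proof.
move=> sl; apply/vinfimums_opp; rewrite opprK superdiff0_opp !image_comp.
rewrite (_ : _ \o _ = fun a => lincomb a f); first exact: sublinear_calcP.
by apply/funext => a /=; rewrite lincombN opprK.
Qed.

Lemma superlinear_calcE psi : superlinear psi ->
  superlinear_calc psi f = - sublinear_calc (fun x => - psi x) f.
Proof.
move=> sl; have infS := infimums_superdiff0 sl.
have [a sa _] := superdiff0_attained 0 sl.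
rewrite /superlinear_calc /infimum; case: ifPn => [/eqP S0|_].
  have : [set lincomb a f | a in superdiff0 psi] (lincomb a f) by exists a.
  by rewrite S0.
by apply: xget_unique => // v vS; exact: is_subset1_infimums vS infS.
Qed.

Lemma superlinear_calcP psi : superlinear psi ->
  infimums [set lincomb a f | a in superdiff0 psi] (superlinear_calc psi f).
Proof.
by move=> sl; rewrite superlinear_calcE //; exact: infimums_superdiff0.
Qed.

Lemma superlinear_calc_le phi psi : sublinear phi -> superlinear psi ->
  (forall x, psi x <= phi x) -> superlinear_calc psi f <= sublinear_calc phi f.
Proof.
move=> slphi slpsi le.
apply: (inf_le_sup (A := superdiff0 psi) (B := subdiff0 phi)).
- move=> x eps eps0; have [a sa ax] := subdiff0_attained x slphi.
  have [b sb bx] := superdiff0_attained x slpsi.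
  by exists b, a; split=> //; rewrite ax bx (le_trans (le x)) // lerDl ltW.
- by move=> a sa; apply: (superlinear_calcP slpsi).1; exists a.
- by move=> b sb; apply: (sublinear_calcP slphi).1; exists b.
Qed.

(** * The value of a positively homogeneous map *)

(** The independence of [h(f)] of the families is the transfer principle for
    subdifferentials against superdifferentials, whose pointwise hypothesis is
    [inf phi = h = sup psi]. *)
Lemma hom_calc_minimax (h : 'rV[R]_n -> R) Fam Gam :
  Fam `<=` sublinear -> Gam `<=` superlinear ->
  pointwise_inf Fam h -> pointwise_sup Gam h ->
  exists v, infimums [set sublinear_calc phi f | phi in Fam] v /\
            supremums [set superlinear_calc psi f | psi in Gam] v.
Proof.
move=> slF slG Fh Gh.
have [phi0 Fphi0 _] : exists2 y, [set phi 0 | phi in Fam] y & y < h 0 + 1.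
  by apply: infimums_adherent (Fh 0) _; rewrite ltrDl.
have [psi0 Gpsi0 _] : exists2 y, [set psi 0 | psi in Gam] y & h 0 - 1 < y.
  by apply: supremums_adherent (Gh 0) _; rewrite gtrBl.
move: Fphi0 Gpsi0 => [{}phi0 Fphi0 _] [{}psi0 Gpsi0 _].
have GF phi psi : Fam phi -> Gam psi ->
    superlinear_calc psi f <= sublinear_calc phi f.
  move=> Fphi Gpsi; apply: superlinear_calc_le; [exact: slF|exact: slG|move=> x].
  apply: (@le_trans _ _ (h x)); first by apply: (Gh x).1; exists psi.
  by apply: (Fh x).1; exists phi.
set SF := [set sublinear_calc phi f | phi in Fam].
set SG := [set superlinear_calc psi f | psi in Gam].
have [v supv] : supremums SG !=set0.
  apply: E_complete; first by exists (superlinear_calc psi0 f); exists psi0.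
  by exists (sublinear_calc phi0 f) => _ [psi Gpsi <-]; exact: GF.
exists v; split=> //; split=> [_ [phi Fphi <-]|u ulb].
  by apply: supv.2 => _ [psi Gpsi <-]; exact: GF.
apply: (inf_sup_le_sup_inf (cA := [set subdiff0 phi | phi in Fam])
  (cB := [set superdiff0 psi | psi in Gam])).
- by move=> _ [phi _ <-]; exact: norm_bounded_subdiff0.
- by move=> _ [psi _ <-]; exact: norm_bounded_superdiff0.
- move=> x eps eps0; have e2 : 0 < eps / 2 by rewrite divr_gt0.
  have [|_ [phi Fphi <-] phix] := infimums_adherent (v := h x + eps / 2) (Fh x).
    by rewrite ltrDl.
  have [|_ [psi Gpsi <-] psix] := supremums_adherent (v := h x - eps / 2) (Gh x).
    by rewrite gtrBl.
  exists (subdiff0 phi), (superdiff0 psi).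
  split; [by exists phi|by exists psi|move=> a b /(_ x) ax /(_ x) bx].
  by rewrite [eps]splitr; lra.
- move=> _ [phi Fphi <-] w wub; apply: (@le_trans _ _ (sublinear_calc phi f)).
    by apply: ulb; exists phi.
  exact: (sublinear_calcP (slF _ Fphi)).2.
- move=> _ [psi Gpsi <-] w wlb; apply: (@le_trans _ _ (superlinear_calc psi f)).
    exact: (superlinear_calcP (slG _ Gpsi)).2.
  by apply: supv.1; exists psi.
Qed.

(** One family of each kind is enough for the value to exist: comparing it with
    any other family of the opposite kind shows that both give the same bound. *)
Lemma hom_calcP (h : 'rV[R]_n -> R) Fam Gam :
  Fam `<=` sublinear -> Gam `<=` superlinear ->
  pointwise_inf Fam h -> pointwise_sup Gam h ->
  is_hom_calc h f (hom_calc h f).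
Proof.
move=> slF slG Fh Gh; have [v [vF vG]] := hom_calc_minimax slF slG Fh Gh.
apply: xgetPex; exists v; split=> [Fam' slF' F'h|Gam' slG' G'h].
  have [v' [v'F v'G]] := hom_calc_minimax slF' slG F'h Gh.
  by rewrite (is_subset1_supremums vG v'G).
have [v' [v'F v'G]] := hom_calc_minimax slF slG' Fh G'h.
by rewrite (is_subset1_infimums vF v'F).
Qed.

(** * Suprema and infima of linear forms, and saddle representations *)

(** The existence of a real supremum forces [T] to be nonempty, whence
    [phi 0 = 0]. *)
Lemma sublinear_supremums (T : Type) (c : T -> 'rV[R]_n) phi :
  (forall x, supremums (range (fun t => dotv (c t) x)) (phi x)) ->
  sublinear phi.
Proof.
move=> sup; have [_ [t0 _ _] _] : exists2 y, range (fun t => dotv (c t) 0) y &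
    phi 0 - 1 < y.
  by apply: supremums_adherent (sup 0) _; rewrite gtrBl.
have ge t x : dotv (c t) x <= phi x by apply: (sup x).1; exists t.
have le x m : (forall t, dotv (c t) x <= m) -> phi x <= m.
  by move=> h; apply: (sup x).2 => _ [t _ <-].
have leZ l x : 0 <= l -> phi (l *: x) <= l * phi x.
  by move=> l0; apply: (le) => t; rewrite dotvZr ler_wpM2l.
split=> [l x l0|x y]; last first.
  by apply: (le) => t; rewrite dotvDr lerD.
apply/le_anti/andP; split; first exact: leZ.
have [->|ln] := eqVneq l 0.
  by rewrite mul0r; apply: le_trans (ge t0 _); rewrite dotvZr mul0r.
rewrite -ler_pdivlMl ?lt_def ?ln // -{1}(scalerK ln x).
by apply: leZ; rewrite invr_ge0.
Qed.

(** The subdifferential of [phi] may be larger than the range of [c] (it is the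
    closed convex hull); the singleton case of the transfer principle shows that
    its elements do not increase the supremum in [E]. *)
Lemma sublinear_calc_supremums (T : Type) (c : T -> 'rV[R]_n) phi :
  (forall x, supremums (range (fun t => dotv (c t) x)) (phi x)) ->
  supremums (range (fun t => lincomb (c t) f)) (sublinear_calc phi f).
Proof.
move=> sup; have [ub lub] := sublinear_calcP (sublinear_supremums sup).
split=> [_ [t _ <-]|w wub].
  by apply: ub; exists (c t) => // x; apply: (sup x).1; exists t.
apply: lub => _ [a sa <-]; apply: (inf_le_sup (A := [set a]) (B := range c)).
- move=> x eps eps0.
  have [|_ [t _ <-] ct] := supremums_adherent (v := phi x - eps) (sup x).
    by rewrite gtrBl.
  exists a, (c t); split=> //.
  by rewrite -lerBlDr (le_trans _ (ltW ct)) // lerB // sa.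
- by move=> _ ->.
- by move=> _ [t _ <-]; apply: wub; exists t.
Qed.

Lemma infimums_dotvN (T : Type) (c : T -> 'rV[R]_n) psi :
  (forall x, infimums (range (fun t => dotv (c t) x)) (psi x)) ->
  forall x, supremums (range (fun t => dotv (- c t) x)) (- psi x).
Proof.
move=> inf x; have /(@infimums_antitone _ _ -%R) := inf x.
rewrite image_comp (_ : _ \o _ = fun t => dotv (- c t) x).
  by apply; [exact: opprK|exact: lerN2].
by apply/funext => t /=; rewrite dotvNl.
Qed.

Lemma superlinear_infimums (T : Type) (c : T -> 'rV[R]_n) psi :
  (forall x, infimums (range (fun t => dotv (c t) x)) (psi x)) ->
  superlinear psi.
Proof. by move=> /infimums_dotvN; exact: sublinear_supremums. Qed.

Lemma superlinear_calc_infimums (T : Type) (c : T -> 'rV[R]_n) psi :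
  (forall x, infimums (range (fun t => dotv (c t) x)) (psi x)) ->
  infimums (range (fun t => lincomb (c t) f)) (superlinear_calc psi f).
Proof.
move=> inf; have /sublinear_calc_supremums sup := infimums_dotvN inf.
rewrite superlinear_calcE; last exact: superlinear_infimums inf.
apply/vinfimums_opp; rewrite opprK image_comp.
rewrite (_ : _ \o _ = fun t => lincomb (- c t) f) //.
by apply/funext => t /=; rewrite lincombN.
Qed.

End HomogeneousCalculus.

Theorem theorem8p3 (R : realType) (n : nat) (E : vectorLatticeType R)
    (E_complete : dedekind_complete E)
    (h : 'rV[R]_n -> R) (h_hom : positively_homogeneous h)
    (h_cont : continuous h) (f : 'I_n -> E)
    (Phi Psi : Type) (a : Phi -> Psi -> 'rV[R]_n)
    (a_saddle : saddle_representation a h) :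
  is_inf_sup (fun phi psi => \sum_(i < n) a phi psi 0 i *: f i) (hom_calc h f)
  /\ is_sup_inf (fun phi psi => \sum_(i < n) a phi psi 0 i *: f i)
       (hom_calc h f).
Proof.
have /choice[s sP] x : exists s : Phi -> R,
    (forall p, supremums (range (fun q => dotv (a p q) x)) (s p)) /\
    infimums (range s) (h x) by exact: (a_saddle x).1.
have /choice[t tP] x : exists t : Psi -> R,
    (forall q, infimums (range (fun p => dotv (a p q) x)) (t q)) /\
    supremums (range t) (h x) by exact: (a_saddle x).2.
have supE p x := (sP x).1 p; have infE q x := (tP x).1 q.
pose Fam := range (fun p x => s x p); pose Gam := range (fun q x => t x q).
have slF : Fam `<=` sublinear.
  by move=> _ [p _ <-]; exact: sublinear_supremums (supE p).
have slG : Gam `<=` superlinear.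
  by move=> _ [q _ <-]; exact: superlinear_infimums (infE q).
have Fh : pointwise_inf Fam h.
  by move=> x; rewrite /Fam image_comp; exact: (sP x).2.
have Gh : pointwise_sup Gam h.
  by move=> x; rewrite /Gam image_comp; exact: (tP x).2.
have [/(_ _ slF Fh) vF /(_ _ slG Gh) vG] :=
  hom_calcP E_complete f slF slG Fh Gh.
split.
  exists (fun p => sublinear_calc (fun x => s x p) f); split=> [p|].
    exact: (sublinear_calc_supremums E_complete f (supE p)).
  by move: vF; rewrite /Fam image_comp.
exists (fun q => superlinear_calc (fun x => t x q) f); split=> [q|].
  exact: (superlinear_calc_infimums E_complete f (infE q)).
by move: vG; rewrite /Gam image_comp.
Qed.
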